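(* For any $\lambda > 0$ there exist constants $k_0$ and $\tau > 0$, depending only on $\lambda$, such that $$\sum_{1 \le n \le N} S(mn,a;q) = \sum_{1 \le n \le N} S(a,mn;q) \ll_{\lambda} N q^{1/2-\tau}$$ holds uniformly for any $q = p^k$ with $p$ an odd prime and $k \ge k_0$ an integer, any integers $m, a$ satisfying $\gcd(ma,p)=1$, and any $N$ with $q^{\lambda} \le N \le q$.
   Context: For integers $n$, $a$ and $q \ge 1$, the Kloosterman sum is $$S(n,a;q) := \sum_{\substack{b \bmod q \\ \gcd(b,q)=1}} e\left(\frac{nb + a\bar{b}}{q}\right),$$ where $e(x) = e^{2\pi i x}$ and $\bar{b}$ is the multiplicative inverse of $b$ modulo $q$. The notation $U \ll_\lambda V$ means $|U| \le cV$ for some constant $c>0$ depending only on $\lambda$. Sums over $n$ are over integers. *)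

(* Defs.v *)
(* MathComp / MathComp-Analysis; complex numbers are [R[i]] over a [realType]. *)
From HB Require Import structures.
From mathcomp Require Import all_boot all_order all_algebra.
From mathcomp Require Import complex.
From mathcomp Require Import all_classical all_reals all_analysis.

Set Implicit Arguments.
Unset Strict Implicit.
Unset Printing Implicit Defensive.

Import Order.TTheory GRing.Theory Num.Theory.
Local Open Scope ring_scope.

(* e(x) = exp(2 pi i x), through its real and imaginary parts. *)
Definition e_unit (R : realType) (x : R) : R[i] :=
  (cos (2 * pi * x) +i* sin (2 * pi * x))%C.

(* The Bezout coefficient of b is an inverse of b modulo q when b and q are
   coprime (see [mul_inv_mod]); other values of b are never used. *)
Definition inv_mod (q b : nat) : nat := (egcdn b q).1.

Lemma mul_inv_mod (q b : nat) :
  coprime b q -> (b * inv_mod q b)%N = 1%N %[mod q].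
Proof.
rewrite /inv_mod; case: b => [|b] cop.
  by move: cop; rewrite /coprime gcd0n => /eqP ->; rewrite !modn1.
have b0 : (0 < b.+1)%N by [].
case: (egcdnP q b0) => u v Hu _ /=.
by rewrite mulnC Hu; move/eqP: cop => ->; rewrite modnMDl.
Qed.

Definition kloosterman (R : realType) (n a : int) (q : nat) : R[i] :=
  \sum_(b < q | coprime b q)
    e_unit ((n * (b : nat)%:Z + a * (inv_mod q b)%:Z)%:~R / q%:R).

(* Main.v *)
Require Import Defs.
From HB Require Import structures.
From mathcomp Require Import all_boot all_order all_algebra.
From mathcomp Require Import complex.
From mathcomp Require Import all_classical all_reals all_analysis.
From mathcomp Require Import ring lra zify.

Set Implicit Arguments.
Unset Strict Implicit.
Unset Printing Implicit Defensive.

Import Order.TTheory GRing.Theory Num.Theory.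
Local Open Scope ring_scope.

(** Write q = p ^ k.  The sum is short, as short as a tiny power of q, so no
    completion argument can help; what makes it small is that, for a prime
    power modulus, the Kloosterman sum is an explicit exponential of a square
    root.

    Evaluation.  The method of stationary phase, carried out p-adically, kills
    every residue b except those close to a root of n b ^ 2 = a.  Near the root
    u the phase n b + a / b equals its critical value 2 n u up to an exactly
    quadratic term, hence S(n, a; q) is the sum over the two roots of
    e(2 n u / q) times a quadratic Gauss sum bounded by sqrt q
    ([kloosterman_evaluation], [ann_gauss_sum_bound]).  The Gauss sum depends
    on n / u only modulo p.

    Linearization.  Let n = n0 + p ^ j x run through a fixed class modulo
    p ^ j.  The root moves p-adically analytically, and 2 n u is a constant
    times the square root of 1 + p ^ j x / n0.  Expanding with the integral series of
    sqrt (1 - 4 y) turns the phase into a polynomial in x, the powers p ^ (j i)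
    with j i >= k being 0 modulo q ([kloosterman_sqrt_phase]).  Its degree is
    about k / j, hence bounded when j is a fixed fraction of k.

    Weyl differencing.  The leading coefficient of this polynomial over q has
    denominator p ^ s up to a factor bounded in terms of the degree, because the
    top coefficient c of the series satisfies d! c = the product of the 4 i - 2
    ([truncated_sqrt_lead]), a fixed nonzero integer.  Choosing p ^ s a small
    power of q, Weyl differencing down to degree one ends with geometric
    progressions of ratio a nontrivial p ^ s-th root of unity, which are bounded
    by p ^ s, except when a shift is divisible by a large power of p, which is
    rare ([weyl_bound]).  Each differencing step costs a square root, so that
    the final saving is a power of q depending only on the degree, that is on
    lambda.  Summing the bounds over the p ^ j classes gives the estimate
    ([kloosterman_sum_bound]).

    The equality of the two sums is the substitution of 1 / b for b. *)

(** * Weyl differencing for a faithful additive character *)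

Lemma sum_triangle (V : nmodType) (F : nat -> nat -> V) X :
  \sum_(0 <= y < X) \sum_(0 <= x < y) F y x =
  \sum_(1 <= h < X) \sum_(0 <= x < X - h) F (x + h)%N x.
Proof.
elim: X => [|X IH]; first by rewrite !big_geq.
rewrite big_nat_recr //= IH; case: X {IH} => [|X].
  by rewrite !big_geq // addr0.
rewrite [in RHS]big_nat_recr //= subSnn big_nat1 add0n.
have -> : \sum_(1 <= h < X.+1) \sum_(0 <= x < X.+2 - h) F (x + h)%N x =
   \sum_(1 <= h < X.+1) (\sum_(0 <= x < X.+1 - h) F (x + h)%N x
      + F X.+1 (X.+1 - h)%N).
  apply: eq_big_nat => h /andP[_ h2].
  rewrite subSn; last exact: ltnW.
  by rewrite big_nat_recr //= subnK // ltnW.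
rewrite big_split /= -addrA; congr (_ + _).
rewrite big_nat_recl //= addrC; congr (_ + _).
rewrite big_add1 /= [LHS]big_nat_rev /= [RHS]big_nat.
rewrite big_nat; apply: eq_bigr => i /andP[_ hi].
by rewrite add0n subSS subnSK.
Qed.

Lemma sqr_norm_sum (C : numClosedFieldType) (u : nat -> C) X :
  `|\sum_(0 <= x < X) u x| ^+ 2 =
  \sum_(0 <= x < X) `|u x| ^+ 2 +
  (\sum_(1 <= h < X) \sum_(0 <= x < X - h) u (x + h)%N * (u x)^* +
   (\sum_(1 <= h < X) \sum_(0 <= x < X - h) u (x + h)%N * (u x)^*)^*).
Proof.
rewrite -(sum_triangle (fun y x => u y * (u x)^*)).
elim: X => [|X IH]; first by rewrite !big_geq // normr0 expr0n /= conjC0 !addr0.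
rewrite !big_nat_recr //= normCK rmorphD mulrDl !mulrDr -!normCK IH.
rewrite rmorphD /= -mulr_sumr -rmorph_sum /= rmorphM /= conjCK.
ring.
Qed.

(** The differences h and - h contribute conjugate terms, so half of them are
    enough, with a factor 2. *)
Lemma van_der_corput (C : numClosedFieldType) (u : nat -> C) X :
  (forall x, `|u x| = 1) ->
  `|\sum_(0 <= x < X) u x| ^+ 2 <= X%:R +
   2 * \sum_(1 <= h < X) `|\sum_(0 <= x < X - h) u (x + h)%N * (u x)^*|.
Proof.
move=> u1; rewrite sqr_norm_sum.
under eq_bigr do rewrite u1 expr1n.
rewrite sumr_const_nat subn0.
set S := \sum_(_ <= _ < _) _.
have le_S : `|S| <= \sum_(1 <= h < X)
   `|\sum_(0 <= x < X - h) u (x + h)%N * (u x)^*| by exact: ler_norm_sum.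
have real_S : S + S^* \is Num.real.
  by rewrite CrealE rmorphD /= conjCK addrC.
rewrite lerD2l; apply: le_trans (real_ler_norm real_S) _.
apply: le_trans (ler_normD _ _) _.
by rewrite norm_conjC -mulr2n -[_ *+ 2]mulr_natl ler_pM2l ?ltr0n.
Qed.

(** A complete period of a nontrivial root of unity sums to 0, so only an
    incomplete period is left; this replaces the usual estimate through the
    distance of the frequency to the nearest integer. *)
Lemma geometric_sum_periodic (C : numDomainType) (w : C) T X :
  w != 1 -> `|w| = 1 -> w ^+ T = 1 -> (0 < T)%N ->
  `|\sum_(0 <= x < X) w ^+ x| <= T%:R.
Proof.
move=> w1 nw wT T0.
have -> : \sum_(0 <= x < X) w ^+ x = \sum_(0 <= x < X %% T) w ^+ x.
  apply: (mulfI (x := w - 1)); first by rewrite subr_eq0.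
  rewrite !big_mkord -!subrX1 {1}(divn_eq X T) exprD mulnC exprM wT expr1n.
  by rewrite mul1r.
apply: le_trans (ler_norm_sum _ _ _) _.
under eq_bigr do rewrite normrX nw expr1n.
by rewrite sumr_const_nat subn0 ler_nat ltnW // ltn_mod.
Qed.

Lemma count_multiples (C : numFieldType) X D :
  (0 < D)%N -> (\sum_(1 <= h < X) (D %| h))%:R <= X%:R / D%:R :> C.
Proof.
move=> D0; rewrite ler_pdivlMr ?ltr0n // -natrM ler_nat.
case: X => [|X]; first by rewrite big_geq.
rewrite -divn_count_dvd; apply: leq_trans (leq_divM _ _) _; exact: leqnSn.
Qed.

(** The forward difference f(x + h) - f(x), written through Taylor's formula so
    that its degree and its leading coefficient can be read off over any
    commutative ring; [n] is a bound on the size of [f]. *)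
Definition poly_diff (R : comNzRingType) (h : R) n (f : {poly R}) : {poly R} :=
  \sum_(1 <= i < n) h ^+ i *: f^`N(i).

Lemma horner_poly_diff (R : comNzRingType) (h : R) n (f : {poly R}) (x : R) :
  (size f <= n)%N -> (0 < n)%N ->
  (poly_diff h n f).[x] = f.[x + h] - f.[x].
Proof.
move=> sf n0; rewrite (nderiv_taylor_wide (mulrC x h) sf) -(prednK n0).
rewrite -(big_mkord xpredT (fun i => f^`N(i).[x] * h ^+ i)) big_nat_recl //.
rewrite nderivn0 expr0 mulr1 [_ + _ - _]addrAC subrr add0r.
rewrite /poly_diff horner_sum big_add1 /=.
by apply: eq_bigr => i _; rewrite hornerZ mulrC.
Qed.

Lemma coef_poly_diff (R : comNzRingType) (h : R) n (f : {poly R}) :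
  (size f <= n.+2)%N -> (poly_diff h n.+2 f)`_n = h * f`_n.+1 *+ n.+1.
Proof.
move=> sf; rewrite /poly_diff coef_sum big_nat_recl // big1_seq /=.
  by rewrite addr0 coefZ coef_nderivn expr1 bin1 mulrnAr add1n.
move=> i; rewrite mem_index_iota => /andP[i1 _].
rewrite coefZ coef_nderivn nth_default ?mul0rn ?mulr0 //.
by apply: leq_trans sf _; rewrite addSn ltnS -addn1 addnC leq_add2r.
Qed.

Lemma size_poly_diff (R : comNzRingType) (h : R) n (f : {poly R}) :
  (size f <= n.+1)%N -> (size (poly_diff h n.+1 f) <= n)%N.
Proof.
move=> sf; apply/leq_sizeP => j nj; rewrite /poly_diff coef_sum big1_seq //=.
move=> i; rewrite mem_index_iota => /andP[i1 _].
rewrite coefZ coef_nderivn nth_default ?mul0rn ?mulr0 //.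
by apply: leq_trans sf _; rewrite -add1n leq_add.
Qed.

Section Weyl.
Variables (R : comNzRingType) (C : numClosedFieldType) (psi : R -> C).
Hypothesis psiD : forall x y, psi (x + y) = psi x * psi y.
Hypothesis psi_norm : forall x, `|psi x| = 1.
Hypothesis psi_inj : forall x, psi x = 1 -> x = 0.

Lemma char0 : psi 0 = 1.
Proof.
have nz : psi 0 != 0 by rewrite -normr_gt0 psi_norm.
by apply: (mulfI nz); rewrite -psiD addr0 mulr1.
Qed.

Lemma charN x : psi (- x) = (psi x)^*.
Proof.
have nz : psi x != 0 by rewrite -normr_gt0 psi_norm.
apply: (mulfI nz); rewrite -psiD subrr char0.
by rewrite -normCK psi_norm expr1n.
Qed.

Lemma charMn x n : psi (x *+ n) = psi x ^+ n.
Proof.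
elim: n => [|n IH]; first by rewrite mulr0n char0 expr0.
by rewrite mulrS psiD IH exprS.
Qed.

(** [B d] bounds a sum of degree d + 1 and of length at most [M]; its recursion
    is one differencing step, where the shifts divisible by p ^ (g + 1) are
    counted trivially.  [dvd_pg] says that any other shift divides p ^ g, so that
    a differencing step loses at most p ^ g in the order of the leading
    coefficient. *)
Variables (p g T : nat) (M : C) (B : nat -> C).
Hypothesis p_gt0 : (0 < p)%N.
Hypothesis T_gt0 : (0 < T)%N.
Hypothesis dvd_pg : forall h, ~~ (p ^ g.+1 %| h)%N ->
  exists z : R, h%:R * z = (p ^ g)%:R.
Hypothesis B_ge0 : forall d, 0 <= B d.
Hypothesis leB0 : T%:R <= B 0.
Hypothesis leBS : forall d,
  M + 2 * M * (B d + M / (p ^ g.+1)%:R) <= B d.+1 ^+ 2.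

(** The two conditions on the leading coefficient A are what differencing
    preserves: A stays in the T-torsion, and (degree)! A, which is multiplied by
    h at each step, stays nonzero as long as it can absorb one factor p ^ g per
    remaining step. *)
Lemma weyl_bound d (f : {poly R}) X :
  (size f <= d.+2)%N -> f`_d.+1 * T%:R = 0 ->
  f`_d.+1 * (d.+1)`!%:R * ((p ^ g) ^ d)%:R != 0 -> X%:R <= M ->
  `|\sum_(0 <= x < X) psi f.[x%:R]| <= B d.
Proof.
elim: d f X => [|d IH] f X sf fT fN leX.
  apply: le_trans leB0; move: fN; rewrite !mulr1 => f1.
  have -> : \sum_(0 <= x < X) psi f.[x%:R] =
      psi f`_0 * \sum_(0 <= x < X) psi f`_1 ^+ x.
    rewrite mulr_sumr; apply: eq_bigr => x _.
    rewrite (horner_coef_wide _ sf) big_ord_recl big_ord1 /= expr0 mulr1 expr1.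
    by rewrite psiD mulr_natr charMn.
  rewrite normrM psi_norm mul1r; apply: geometric_sum_periodic => //.
    by apply: contra f1 => /eqP/psi_inj/eqP.
  by rewrite -charMn -mulr_natr fT char0.
have M0 : 0 <= M by apply: le_trans leX; rewrite ler0n.
rewrite -(@ler_pXn2r _ 2) ?nnegrE ?normr_ge0 //.
apply: le_trans (leBS d); apply: le_trans (van_der_corput _ _) _ => //.
apply: lerD => //; rewrite -mulrA ler_pM2l ?ltr0n //.
have step h :
   `|\sum_(0 <= x < X - h) psi f.[(x + h)%:R] * (psi f.[x%:R])^*| <=
    B d + M * (p ^ g.+1 %| h)%:R.
  have leXh : (X - h)%:R <= M.
    by apply: le_trans leX; rewrite ler_nat leq_subr.
  case dv: (p ^ g.+1 %| h)%N; last first.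
    rewrite mulr0 addr0.
    have -> : \sum_(0 <= x < X - h) psi f.[(x + h)%:R] * (psi f.[x%:R])^* =
       \sum_(0 <= x < X - h) psi (poly_diff h%:R d.+3 f).[x%:R].
      by apply: eq_bigr => x _; rewrite horner_poly_diff // psiD charN natrD.
    apply: IH => //; first exact: size_poly_diff.
      rewrite coef_poly_diff // -[(_ * _) *+ d.+2]mulr_natr.
      transitivity (f`_d.+2 * T%:R * (h%:R * d.+2%:R)); first by ring.
      by rewrite fT mul0r.
    have [z hz] := dvd_pg (negbT dv).
    apply: contra fN => /eqP H; apply/eqP.
    move: H; rewrite coef_poly_diff // => /(congr1 (fun t => t * z)).
    rewrite mul0r => Hz; apply: etrans Hz.
    by rewrite factS expnS !natrM -hz -[(_ * _) *+ d.+2]mulr_natr; ring.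
  rewrite mulr1; apply: le_trans (_ : M <= _); last by rewrite lerDr.
  apply: le_trans leXh; apply: le_trans (ler_norm_sum _ _ _) _.
  under eq_bigr do rewrite normrM norm_conjC !psi_norm mulr1.
  by rewrite sumr_const_nat subn0.
apply: le_trans (ler_sum_nat _) _; first by move=> h _; exact: step.
rewrite big_split /= sumr_const_nat mulrDr; apply: lerD.
  rewrite -mulr_natl ler_wpM2r // (le_trans _ leX) // ler_nat.
  by rewrite leq_subr.
rewrite -mulr_sumr ler_wpM2l // -natr_sum.
apply: le_trans (count_multiples C _ _) _; first by rewrite expn_gt0 p_gt0.
by rewrite ler_pM2r // invr_gt0 ltr0n expn_gt0 p_gt0.
Qed.

End Weyl.

(** * The ring of integers modulo a prime power *)

Lemma expr1D_linear (R : comNzRingType) (y : R) n :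
  exists z, (1 + y) ^+ n = 1 + n%:R * y + y ^+ 2 * z.
Proof.
elim: n => [|n [z IH]]; first by exists 0; ring.
by exists (n%:R + z + y * z); rewrite exprS IH -natr1; ring.
Qed.

Lemma expr1D_prime_power (R : comNzRingType) (p : nat) (y : R) i :
  exists z, (1 + p%:R * y) ^+ (p ^ i) = 1 + (p ^ i.+1)%:R * z.
Proof.
elim: i => [|i [z IH]]; first by exists y; rewrite expr1.
have [t ht] := expr1D_linear ((p ^ i.+1)%:R * z) p.
exists (z + (p ^ i)%:R * z ^+ 2 * t).
by rewrite expnSr exprM IH ht !expnS !natrM; ring.
Qed.

Section PrimePowerRing.
Variables (p k : nat).
Hypothesis p_pr : prime p.
Hypothesis k_gt0 : (0 < k)%N.
Local Notation Zq := 'Z_(p ^ k).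

Lemma prime_power_gt1 : (1 < p ^ k)%N.
Proof. by rewrite -(exp1n k) ltn_exp2r // prime_gt1. Qed.

Lemma Zq_natr (x : Zq) : x = (x : nat)%:R.
Proof. by rewrite natr_Zp. Qed.

Lemma natr_Zq_eq0 n : (n%:R == 0 :> Zq) = (p ^ k %| n)%N.
Proof. by rewrite -(inj_eq val_inj) /= val_Zp_nat ?prime_power_gt1. Qed.

Lemma intr_Zq_eq0 (z : int) : (z%:~R == 0 :> Zq) = (p ^ k %| `|z|)%N.
Proof.
case: z => n; first by rewrite -pmulrn natr_Zq_eq0.
by rewrite NegzE mulrNz oppr_eq0 -pmulrn natr_Zq_eq0.
Qed.

Lemma pX_eq0 i : (k <= i)%N -> (p ^ i)%:R = 0 :> Zq.
Proof. by move=> ki; apply/eqP; rewrite natr_Zq_eq0 dvdn_exp2l. Qed.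

Lemma pX_neq0 i : (i < k)%N -> (p ^ i)%:R != 0 :> Zq.
Proof. by move=> ik; rewrite natr_Zq_eq0 dvdn_Pexp2l ?prime_gt1 // -ltnNge. Qed.

Lemma annP i (x : Zq) : (i <= k)%N -> (p ^ i)%:R * x = 0 ->
  exists2 n, (n < p ^ i)%N & x = (p ^ (k - i))%:R * n%:R.
Proof.
move=> ik; have pi0 j : (0 < p ^ j)%N by rewrite expn_gt0 prime_gt0.
rewrite [x in _ * x]Zq_natr -natrM => /eqP.
rewrite natr_Zq_eq0 -{1}(subnKC ik) expnD dvdn_pmul2l // => /dvdnP[n hn].
exists n; last by rewrite -natrM mulnC -hn natr_Zp.
have := ltn_ord x; rewrite [X in (_ < X)%N]Zp_cast ?prime_power_gt1 // hn.
by rewrite -{2}(subnKC ik) expnD ltn_pmul2r.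
Qed.

Lemma unit_Zq_natr n : ((n%:R : Zq) \is a GRing.unit) = ~~ (p %| n)%N.
Proof. by rewrite unitZpE ?prime_power_gt1 // coprime_pexpl // prime_coprime. Qed.

Lemma pM_nonunit (z : Zq) : p%:R * z \isn't a GRing.unit.
Proof. by rewrite unitrM unit_Zq_natr dvdnn. Qed.

Lemma nonunitP (x : Zq) : x \isn't a GRing.unit -> exists z, x = p%:R * z.
Proof.
rewrite [x]Zq_natr unit_Zq_natr negbK => /dvdnP[n ->].
by exists n%:R; rewrite natrM mulrC.
Qed.

Lemma unitDp (x z : Zq) : x \is a GRing.unit -> x + p%:R * z \is a GRing.unit.
Proof.
apply: contraLR => /nonunitP[t ht].
by rewrite (_ : x = p%:R * (t - z)) ?pM_nonunit // mulrBr -ht addrK.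
Qed.

(** Since (1 + p z) ^ (p ^ (k - 1)) = 1 and that exponent is odd, half of the
    next integer is an exponent that extracts square roots; this does the work
    of Hensel's lemma. *)
Lemma sqrt_1Dp (z : Zq) : odd p -> exists w, w ^+ 2 = 1 + p%:R * z.
Proof.
move=> odd_p; exists ((1 + p%:R * z) ^+ (p ^ k.-1).+1./2).
have [t ht] := expr1D_prime_power p z k.-1.
rewrite -exprM muln2 halfK /= oddX odd_p orbT subn0.
by rewrite exprS ht prednK // pX_eq0 // mul0r addr0 mulr1.
Qed.

Variables (C : numClosedFieldType) (psi : Zq -> C).
Hypothesis psiD : forall x y, psi (x + y) = psi x * psi y.
Hypothesis psi_norm : forall x, `|psi x| = 1.
Hypothesis psi_inj : forall x, psi x = 1 -> x = 0.

Lemma char_orthogonality (y : Zq) :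
  \sum_(t : Zq) psi (t * y) = if y == 0 then (p ^ k)%:R else 0.
Proof.
case: eqP => [->|y0].
  under eq_bigr do rewrite mulr0 (char0 psiD psi_norm).
  by rewrite sumr_const card_ord Zp_cast ?prime_power_gt1.
have: \sum_(t : Zq) psi (t * y) = psi y * \sum_(t : Zq) psi (t * y).
  rewrite {1}(reindex_inj (addIr (1 : Zq))) mulr_sumr /=.
  by apply: eq_bigr => t _; rewrite mulrDl mul1r psiD mulrC.
move/eqP; rewrite -subr_eq0 -{1}[\sum_t _]mul1r -mulrBl mulf_eq0.
case/orP => [|/eqP//]; rewrite subr_eq0 eq_sym => /eqP /psi_inj //.
Qed.

(** * Stationary phase for Kloosterman sums *)

Definition kloosterman_char (n a : Zq) : C :=
  \sum_(b | b \is a GRing.unit) psi (n * b + a / b).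

Lemma kloosterman_charC n a : kloosterman_char n a = kloosterman_char a n.
Proof.
rewrite /kloosterman_char (reindex_inj invr_inj) /=; apply: eq_big => b.
  by rewrite unitrV.
by rewrite unitrV => ub; rewrite invrK addrC.
Qed.

(** Substituting b (1 + p ^ r t) for b multiplies the summand by a character of
    t, since (p ^ r) ^ 2 = 0; averaging over t keeps exactly the b at which this
    character is trivial. *)
Lemma kloosterman_stationary_phase r n a : (k <= 2 * r)%N ->
  kloosterman_char n a =
  \sum_(b | (b \is a GRing.unit) && ((p ^ r)%:R * (n * b ^+ 2 - a) == 0))
     psi (n * b + a / b).
Proof.
move=> kr; pose P : Zq := (p ^ r)%:R.
have PP : P * P = 0 by rewrite -natrM -expnD addnn -mul2n pX_eq0.
have q0 : (p ^ k)%:R != 0 :> C by rewrite pnatr_eq0 -lt0n ltnW ?prime_power_gt1.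
apply: (mulfI q0).
transitivity (\sum_(t : Zq) kloosterman_char n a).
  by rewrite sumr_const card_ord Zp_cast ?prime_power_gt1 // mulr_natl.
have step (t : Zq) : kloosterman_char n a = \sum_(b | b \is a GRing.unit)
    psi (n * b + a / b) * psi (t * (P * (n * b - a / b))).
  have u1 : (1 + P * t) * (1 - P * t) = 1.
    by transitivity (1 - P * P * t ^+ 2); [ring | rewrite PP mul0r subr0].
  have U : 1 + P * t \is a GRing.unit by apply/unitrPr; exists (1 - P * t).
  have UV : (1 + P * t)^-1 = 1 - P * t by apply: (mulrI U); rewrite u1 divrr.
  rewrite /kloosterman_char (reindex_inj (mulIr U)) /=; apply: eq_big => b.
    by rewrite unitrM U andbT.
  rewrite unitrM U andbT => ub.
  by rewrite invrM // UV -psiD; congr psi; ring.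
under eq_bigr => t _ do rewrite (step t).
rewrite exchange_big /= mulr_sumr big_mkcondr /=; apply: eq_bigr => b ub.
rewrite -mulr_sumr char_orthogonality mulrC.
have -> : (P * (n * b - a / b) == 0) = ((p ^ r)%:R * (n * b ^+ 2 - a) == 0).
  rewrite -(inj_eq (mulIr ub)) mul0r; congr (_ == _); rewrite -/P.
  rewrite -mulrA; congr (_ * _); rewrite mulrBl divrK //; ring.
by case: ifP => _; rewrite ?mul0r.
Qed.

(** The exponent r is half of k rounded up.  The annihilator of p ^ r then
    consists of the multiples of p ^ (k - r), and the last two conditions say
    that p times a square and any cube vanish there. *)
Section Evaluation.
Variable r : nat.
Hypothesis r_lt : (r < k)%N.
Hypothesis kr : (k <= 2 * r)%N.
Hypothesis kr2 : (k <= 2 * (k - r) + 1)%N.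
Hypothesis kr3 : (k <= 3 * (k - r))%N.

Lemma kloosterman_nonunit n a :
  n \isn't a GRing.unit -> a \is a GRing.unit -> kloosterman_char n a = 0.
Proof.
move=> nn ua; rewrite (kloosterman_stationary_phase _ _ kr) big1 // => b.
case/andP=> ub /eqP H.
have [z nz] := nonunitP nn.
suff U : n * b ^+ 2 - a \is a GRing.unit.
  by move: (pX_neq0 r_lt); rewrite -(inj_eq (mulIr U)) H mul0r eqxx.
rewrite -unitrN (_ : - _ = a + p%:R * (- z * b ^+ 2)) ?unitDp //.
by rewrite nz; ring.
Qed.

(** A stationary point solves n b ^ 2 = a modulo p only, but [sqrt_1Dp] corrects
    it into an exact solution. *)
Lemma kloosterman_nonresidue n a :
  odd p -> n \is a GRing.unit -> a \is a GRing.unit ->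
  (forall u, n * u ^+ 2 != a) -> kloosterman_char n a = 0.
Proof.
move=> odd_p un ua H.
rewrite (kloosterman_stationary_phase _ _ kr) big1 // => b /andP[ub /eqP Hb].
have [z _ hz] := annP (ltnW r_lt) Hb.
have [i hi] : exists i, (k - r = i.+1)%N.
  by exists (k - r).-1; rewrite prednK // subn_gt0.
have [w hw] := sqrt_1Dp ((p ^ i)%:R * z%:R / a) odd_p.
have E : n * b ^+ 2 = a * w ^+ 2.
  rewrite hw mulrDr mulr1 -[LHS](subrK a) hz hi expnS natrM addrC; congr (_ + _).
  transitivity (a / a * (p%:R * (p ^ i)%:R * z%:R)); last by ring.
  by rewrite divrr // mul1r.
have uw : w \is a GRing.unit.
  by rewrite -(unitrX_pos _ (n := 2)) // hw unitDp // unitr1.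
have /eqP[] := H (b / w).
by rewrite exprMn exprVn mulrA E mulrK // unitrX.
Qed.

(** The contribution of the neighbourhood of a stationary point: a quadratic
    Gauss sum modulo 1 or p, according to the parity of k, with multiplicity. *)
Definition ann_gauss_sum (c : Zq) : C :=
  \sum_(v | (p ^ r)%:R * v == 0) psi (c * v ^+ 2).

Lemma ann_sqr (v : Zq) : (p ^ r)%:R * v = 0 -> p%:R * v ^+ 2 = 0 /\ v ^+ 3 = 0.
Proof.
move=> /(annP (ltnW r_lt))[z _ ->]; split.
  transitivity ((p ^ (2 * (k - r) + 1))%:R * z%:R ^+ 2 : Zq).
    rewrite addn1 expnS natrM [(2 * _)%N]mulnC expnM.
    by rewrite [X in _ = _ * X * _]natrX; ring.
  by rewrite pX_eq0 ?mul0r.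
transitivity ((p ^ (3 * (k - r)))%:R * z%:R ^+ 3 : Zq).
  by rewrite mulnC expnM [X in _ = X * _]natrX; ring.
by rewrite pX_eq0 ?mul0r.
Qed.

Lemma ann_gauss_sumDp c z : ann_gauss_sum (c + p%:R * z) = ann_gauss_sum c.
Proof.
apply: eq_bigr => v /eqP/ann_sqr[pv _]; congr psi.
transitivity (c * v ^+ 2 + z * (p%:R * v ^+ 2)); first by ring.
by rewrite pv mulr0 addr0.
Qed.

Lemma card_ann i :
  (i <= k)%N -> (#|[pred v : Zq | ((p ^ i)%:R * v == 0)%R]| <= p ^ i)%N.
Proof.
move=> ik; pose f (n : 'I_(p ^ i)) : Zq := (p ^ (k - i))%:R * (n : nat)%:R.
rewrite -[X in (_ <= X)%N]card_ord; apply: leq_trans (leq_image_card f _).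
apply/subset_leq_card/fintype.subsetP => v.
rewrite inE => /eqP /(annP ik)[n ln ->].
by apply/fintype.imageP; exists (Ordinal ln).
Qed.

Lemma two_unit : odd p -> (2 : Zq) \is a GRing.unit.
Proof.
move=> odd_p; rewrite unit_Zq_natr dvdn_prime2 //.
by apply: contraL odd_p => /eqP->.
Qed.

(** In the square of the modulus, the sum over v = w + h becomes, for each h, a
    linear sum over w, which vanishes unless p ^ (k - r) h = 0: this leaves
    p ^ (k - r) differences, each contributing p ^ r. *)
Lemma ann_gauss_sum_bound c :
  odd p -> c \is a GRing.unit -> `|ann_gauss_sum c| ^+ 2 <= (p ^ k)%:R.
Proof.
move=> odd_p uc; pose I := [pred v : Zq | (p ^ r)%:R * v == 0].
have sumI (y : Zq) : `|\sum_(w | I w) psi (w * y)| <=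
    if (p ^ (k - r))%:R * y == 0 then (p ^ r)%:R else 0.
  case: eqP => [_|ny].
    apply: le_trans (ler_norm_sum _ _ _) _.
    under eq_bigr do rewrite psi_norm.
    by rewrite sumr_const ler_nat card_ann // ltnW.
  have: \sum_(w | I w) psi (w * y) =
      psi ((p ^ (k - r))%:R * y) * \sum_(w | I w) psi (w * y).
    rewrite {1}(reindex_inj (addIr ((p ^ (k - r))%:R : Zq))) mulr_sumr /=.
    apply: eq_big => w; last by move=> _; rewrite mulrDl psiD mulrC.
    rewrite mulrDr -natrM -expnD subnKC; last exact: ltnW.
    by rewrite (pX_eq0 (leqnn k)) addr0.
  move/eqP; rewrite -subr_eq0 -{1}[\sum_(_ | _) _]mul1r -mulrBl mulf_eq0.
  case/orP => [|/eqP->]; last by rewrite normr0.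
  by rewrite subr_eq0 eq_sym => /eqP /psi_inj.
have E : `|ann_gauss_sum c| ^+ 2 =
    \sum_(h | I h) psi (c * h ^+ 2) * \sum_(w | I w) psi (w * (2 * c * h)).
  rewrite normCK /ann_gauss_sum rmorph_sum /= mulr_sumr.
  under [RHS]eq_bigr do rewrite mulr_sumr.
  rewrite [RHS]exchange_big /=; apply: eq_bigr => w /eqP Iw.
  rewrite mulr_suml (reindex_inj (addIr w)) /=; apply: eq_big => h.
    by rewrite mulrDr Iw addr0.
  by move=> _; rewrite -(charN psiD psi_norm) -!psiD; congr psi; ring.
rewrite -[X in X <= _]ger0_norm ?exprn_ge0 // E.
apply: le_trans (ler_norm_sum _ _ _) _.
under eq_bigr do rewrite normrM psi_norm mul1r.
apply: le_trans (ler_sum _ (fun h _ => sumI _)) _.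
rewrite -big_mkcondr /= sumr_const -mulrnA ler_nat.
rewrite -[X in (_ <= p ^ X)%N](subnKC (ltnW r_lt)) expnD leq_mul2l.
apply/orP; right.
apply: leq_trans (card_ann (leq_subr r k)).
apply/subset_leq_card/fintype.subsetP => h.
rewrite !inE => /andP[_ /eqP H]; apply/eqP.
have U : 2 * c \is a GRing.unit by rewrite unitrM two_unit.
by apply: (mulIr U); rewrite mul0r -mulrA [h * _]mulrC.
Qed.

(** With b = u + v, one has n b + n u ^ 2 / b = 2 n u + n v ^ 2 / b, where b can
    be replaced by u because v ^ 3 = 0. *)
Lemma stationary_half u n : n \is a GRing.unit -> u \is a GRing.unit ->
  \sum_(b | (b \is a GRing.unit) && ((p ^ r)%:R * (b - u) == 0))
     psi (n * b + n * u ^+ 2 / b) = psi (2 * n * u) * ann_gauss_sum (n / u).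
Proof.
move=> un uu.
rewrite (reindex_inj (addrI u)) /= mulr_sumr; apply: eq_big => v.
  rewrite addrAC subrr add0r andbC; case: eqP => //= H.
  have [z _ ->] := annP (ltnW r_lt) H.
  rewrite (_ : (k - r = (k - r).-1.+1)%N); last by rewrite prednK // subn_gt0.
  by rewrite expnS natrM -mulrA unitDp.
case/andP=> ub /eqP; rewrite addrAC subrr add0r => H.
have [_ v3] := ann_sqr H; rewrite -psiD; congr psi.
apply: (mulIr ub); apply: (mulIr uu); rewrite mulrDl divrK //.
rewrite mulrAC [RHS]mulrAC [in RHS]mulrDl [_ * v ^+ 2 * u]mulrAC divrK //.
transitivity ((2 * n * u * u + n * v ^+ 2) * (u + v) - n * v ^+ 3); first by ring.
by rewrite v3 mulr0 subr0.
Qed.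

(** Since p is odd it cannot divide both b - u and b + u, so the stationary
    points split into the neighbourhoods of u and of - u. *)
Lemma kloosterman_evaluation u n :
  odd p -> n \is a GRing.unit -> u \is a GRing.unit ->
  kloosterman_char n (n * u ^+ 2) = psi (2 * n * u) * ann_gauss_sum (n / u)
     + psi (- (2 * n * u)) * ann_gauss_sum (- (n / u)).
Proof.
move=> odd_p un uu; rewrite (kloosterman_stationary_phase _ _ kr).
have P0 := pX_neq0 r_lt; set P := (p ^ r)%:R in P0 *.
have cond b : (P * (n * b ^+ 2 - n * u ^+ 2) == 0) =
    (P * (b - u) == 0) || (P * (b - - u) == 0).
  rewrite opprK.
  have -> : P * (n * b ^+ 2 - n * u ^+ 2) = P * (b - u) * (b + u) * n by ring.
  rewrite -[X in _ * _ * _ == X](mul0r n) (inj_eq (mulIr un)).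
  apply/eqP/orP; last first.
    by case=> /eqP E; [rewrite E mul0r | rewrite mulrAC E mul0r].
  case: (boolP (b - u \is a GRing.unit)) => [U | /nonunitP[z hz]] E.
    by right; rewrite -(inj_eq (mulIr U)) mul0r mulrAC E.
  have U : b + u \is a GRing.unit.
    rewrite (_ : b + u = 2 * u + p%:R * z); last by rewrite -hz; ring.
    by rewrite unitDp // unitrM two_unit.
  by left; rewrite -(inj_eq (mulIr U)) mul0r E.
rewrite (bigID (fun b => P * (b - u) == 0)) /=; congr (_ + _).
  rewrite -stationary_half //; apply: eq_bigl => b; rewrite cond.
  by rewrite -/P -andbA; case: (P * (b - u) == 0); rewrite ?orbT ?andbF.
have uN : - u \is a GRing.unit by rewrite unitrN.
rewrite -[- (2 * n * u)]mulrN -[- (n / u)]mulrN -invrN -stationary_half // sqrrN.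
apply: eq_bigl => b; rewrite cond.
rewrite -/P -andbA; congr (_ && _).
case: (P * (b - u) =P 0) => [E|_]; rewrite ?andbT ?andbF //.
apply/esym/negP => /eqP E'.
have U : 2 * u \is a GRing.unit by rewrite unitrM two_unit.
case/eqP: P0; apply: (mulIr U); rewrite mul0r.
by transitivity (P * (b - - u) - P * (b - u)); [ring | rewrite E E' subr0].
Qed.
End Evaluation.
End PrimePowerRing.

(** * The integral power series of the square root of 1 - 4y *)

(** If 1 + 2 B is a square root of 1 - 4y then B = - y - B ^ 2, and iterating
    this equation converges y-adically without any denominator. *)
Fixpoint sqrt_iter (d : nat) : {poly int} :=
  if d is i.+1 then - 'X - sqrt_iter i ^+ 2 else 0.

Lemma sqrt_iter_dvdX i : exists E, sqrt_iter i = 'X * E.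
Proof.
elim: i => [|i [E IH]]; first by exists 0; rewrite mulr0.
by exists (- 1 - 'X * E ^+ 2); rewrite /= IH; ring.
Qed.

Lemma sqrt_iter_step i : exists E, sqrt_iter i.+1 = sqrt_iter i + 'X^(i.+1) * E.
Proof.
elim: i => [|i [E IH]]; first by exists (-1); rewrite /= expr0n /=; ring.
have [F hF] := sqrt_iter_dvdX i; have [G hG] := sqrt_iter_dvdX i.+1.
exists (- E * (F + G)).
have hb : sqrt_iter i.+1 = - 'X - sqrt_iter i ^+ 2 by [].
have -> : sqrt_iter i.+2 = - 'X - sqrt_iter i.+1 ^+ 2 by [].
move: (sqrt_iter i) (sqrt_iter i.+1) hF hG IH hb => a b hF hG IH hb.
have hX : 'X^(i.+1) * E = b - a by rewrite IH addrAC subrr add0r.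
transitivity (b - 'X^(i.+1) * E * (a + b)); first by rewrite hX hb; ring.
by rewrite hF hG !exprS; ring.
Qed.

Lemma truncated_sqrt d : exists (c E : {poly int}),
  [/\ (size c <= d.+1)%N, c`_0 = 1 & c ^+ 2 = 1 - 4 * 'X + 'X^(d.+1) * E].
Proof.
have [E hE] := sqrt_iter_step d; have [F hF] := sqrt_iter_dvdX d.
pose c := 1 + 2 * sqrt_iter d.
have c2 : c ^+ 2 = 1 - 4 * 'X - 'X^(d.+1) * (4 * E).
  transitivity (1 - 4 * 'X + 4 * (sqrt_iter d - sqrt_iter d.+1)).
    by rewrite /c /=; ring.
  by rewrite hE; ring.
have := poly_take_drop d.+1 c; set t := take_poly _ _; set D := drop_poly _ _ => hc.
exists t, (- (4 * E) - 2 * t * D - 'X^(d.+1) * D ^+ 2); split.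
- exact: size_take_poly.
- by rewrite coef_take_poly ltn0Sn /c hF mulrCA coefD coef1 coefXM /= addr0.
have -> : t = c - D * 'X^(d.+1) by rewrite -hc addrK.
transitivity (c ^+ 2 - 2 * c * D * 'X^(d.+1) + D ^+ 2 * 'X^(d.+1) ^+ 2).
  by ring.
by rewrite c2; ring.
Qed.

(** The square root c satisfies (1 - 4y) c' = - 2 c up to the order of
    truncation, which gives (i + 1) c_(i+1) = (4 i - 2) c_i. *)
Lemma truncated_sqrt_lead d (c E : {poly int}) :
  c ^+ 2 = 1 - 4 * 'X + 'X^(d.+1) * E -> c`_0 = 1 ->
  d`!%:R * c`_d = \prod_(i < d) (4 * (i : nat)%:R - 2).
Proof.
move=> c2 c0.
have [F key] : exists F,
    2 * ((1 - 4 * 'X) * c^`() + 2 * c) = 'X^d * F :> {poly int}.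
  have := congr1 (fun f => f^`()) c2.
  rewrite expr2 derivM derivD derivM derivXn /=.
  have -> : (1 - 4 * 'X)^`() = - 4 :> {poly int}.
    by rewrite mulr_natl derivB derivMn derivX -polyC1 derivC sub0r.
  set c' := c^`() => c2'.
  exists (c * (E *+ d.+1 + 'X * E^`()) - 2 * 'X * E * c').
  have E1 : 2 * c * c' = - 4 + 'X^d * (E *+ d.+1 + 'X * E^`()).
    transitivity (c' * c + c * c'); first by ring.
    by rewrite c2' exprS -[in LHS]mulr_natr -[in RHS]mulr_natr; ring.
  transitivity (c * (2 * c * c') - 2 * 'X^(d.+1) * E * c' + 4 * c); last first.
    by rewrite E1 exprS; ring.
  transitivity (2 * (1 - 4 * 'X) * c' + 4 * c); first by ring.
  have -> : 1 - 4 * 'X = c ^+ 2 - 'X^(d.+1) * E by rewrite c2 addrK.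
  by ring.
have rec i : (i < d)%N -> i.+1%:R * c`_i.+1 = (4 * i%:R - 2) * c`_i.
  move=> id; have := congr1 (fun f : {poly int} => f`_i) key.
  rewrite coefXnM id [2 * (_ + _)]mulr_natl coefMn coefD mulrBl mul1r coefB.
  rewrite -[4 * 'X * _]mulrA [4 * ('X * _)]mulr_natl [2 * c]mulr_natl !coefMn.
  rewrite coefXM !coef_deriv => /eqP.
  rewrite mulrn_eq0 /= => /eqP; case: i id => [|i] id /= H;
      apply/eqP; rewrite -subr_eq0; apply/eqP; apply: etrans H.
    by ring.
  by ring.
suff H i : (i <= d)%N -> i`!%:R * c`_i = \prod_(j < i) (4 * (j : nat)%:R - 2).
  exact: H.
elim: i => [|i IH] id; first by rewrite big_ord0 c0 mulr1.
rewrite big_ord_recr /= -IH; last exact: ltnW.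
by rewrite factS mulnC natrM -mulrA rec //; ring.
Qed.

(** * Sums over residue classes modulo a power of p *)

Lemma sum_residue_classes (V : nmodType) (F : nat -> V) P L : (0 < P)%N ->
  \sum_(0 <= n < L) F n =
  \sum_(0 <= i < P) \sum_(0 <= x < L %/ P + (i < L %% P)) F (i + P * x)%N.
Proof.
move=> P0; elim: L => [|L IH].
  rewrite big_geq // div0n mod0n big1 // => i _; by rewrite big_geq.
have step i : (i < P)%N -> (L.+1 %/ P + (i < L.+1 %% P) =
    (L %/ P + (i < L %% P)) + (i == L %% P))%N.
  move=> iP; have rP := ltn_pmod L P0.
  have : (L.+1 = L %/ P * P + (L %% P).+1)%N by rewrite addnS -divn_eq.
  move: (L %/ P)%N (L %% P)%N rP => c r rP ->.
  rewrite divnMDl // modnMDl.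
  have [rP'|] := ltnP r.+1 P.
    rewrite divn_small // modn_small // addn0 -addnA; congr (_ + _)%N.
    by rewrite ltnS leq_eqVlt; case: ltngtP.
  move=> Pr; have -> : r.+1 = P by apply/eqP; rewrite eqn_leq rP Pr.
  rewrite divnn P0 modnn ltn0 addn0 -addnA; congr (_ + _)%N.
  by lia.
rewrite big_nat_recr //= IH.
rewrite [RHS](eq_big_nat _ _ (F2 := fun i =>
    \sum_(0 <= x < L %/ P + (i < L %% P)) F (i + P * x)%N
    + (if i == (L %% P)%N then F L else 0))).
  rewrite big_split /=; congr (_ + _).
  rewrite (bigD1_seq (L %% P)%N) ?iota_uniq ?mem_index_iota ?ltn_pmod //= eqxx.
  by rewrite big1 ?addr0 // => i /negbTE->.
move=> i /andP[_ iP]; rewrite step //.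
case: eqP => [->|_]; last by rewrite addn0 addr0.
rewrite ltnn addn1 addn0 big_nat_recr //=; congr (_ + F _).
by rewrite addnC mulnC -divn_eq.
Qed.

Lemma unitr_of_mul_sqr (R : comUnitRingType) (n u : R) :
  n * u ^+ 2 \is a GRing.unit -> u \is a GRing.unit.
Proof. by rewrite unitrM unitrX_pos // => /andP[]. Qed.

Lemma horner_1DX (R : comNzRingType) (f : {poly R}) y :
  exists z, f.[y] = f`_0 + y * z.
Proof.
elim/poly_ind: f => [|f b _]; first by exists 0; rewrite horner0 coef0 mulr0 addr0.
by exists f.[y]; rewrite hornerMXaddC coefD coefMX coefC /= add0r addrC mulrC.
Qed.

Section ClassSum.
Variables (p k : nat).
Hypothesis p_pr : prime p.
Hypothesis odd_p : odd p.
Hypothesis k_gt1 : (1 < k)%N.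
Local Notation Zq := 'Z_(p ^ k).
Let k_gt0 : (0 < k)%N := ltnW k_gt1.

Lemma dvd_prime_power_Zq g h :
  ~~ (p ^ g.+1 %| h)%N -> exists z : Zq, h%:R * z = (p ^ g)%:R.
Proof.
move=> nd; have h0 : (0 < h)%N by case: h nd => //; rewrite dvdn0.
have [u v E _] := egcdnP (p ^ k) h0.
have /(dvdn_pfactor _ _ p_pr)[i ik Ei] := dvdn_gcdr h (p ^ k).
have ig : (i <= g)%N.
  rewrite leqNgt; apply: contra nd => gi.
  by apply: dvdn_trans (dvdn_exp2l p gi) _; rewrite -Ei dvdn_gcdl.
exists (u * p ^ (g - i))%:R; rewrite -natrM mulnA [(h * u)%N]mulnC E Ei.
rewrite mulnDl natrD -expnD subnKC // [in X in X + _]mulnAC natrM.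
by rewrite (pX_eq0 p_pr k_gt0 (leqnn k)) mulr0 add0r.
Qed.

Variables (C : numClosedFieldType) (psi : Zq -> C).
Hypothesis psiD : forall x y, psi (x + y) = psi x * psi y.
Hypothesis psi_norm : forall x, `|psi x| = 1.
Hypothesis psi_inj : forall x, psi x = 1 -> x = 0.

Let r := (k - k./2)%N.
Let r_lt : (r < k)%N. Proof. by rewrite /r; lia. Qed.
Let kr : (k <= 2 * r)%N. Proof. by rewrite /r; lia. Qed.
Let kr2 : (k <= 2 * (k - r) + 1)%N. Proof. by rewrite /r; lia. Qed.
Let kr3 : (k <= 3 * (k - r))%N. Proof. by rewrite /r; lia. Qed.

(** Here y is the displacement inside the residue class.  The root attached to
    n (1 - 4y) is u c(y) / (1 - 4y), whose critical value is 2 n u c(y); modulo p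
    it is u, so the Gauss sums are the same throughout the class. *)
Lemma kloosterman_sqrt_phase d (c E : {poly int}) (a n u y : Zq) :
  c ^+ 2 = 1 - 4 * 'X + 'X^(d.+1) * E -> c`_0 = 1 -> y ^+ d.+1 = 0 ->
  (exists z, y = p%:R * z) ->
  n \is a GRing.unit -> u \is a GRing.unit -> a = n * u ^+ 2 ->
  let phase := 2 * n * u * (map_poly intr c).[y] in
  kloosterman_char psi (n * (1 - 4 * y)) a =
    psi phase * ann_gauss_sum psi r (n / u)
    + psi (- phase) * ann_gauss_sum psi r (- (n / u)).
Proof.
move=> c2 c0 yd [z yz] un uu aE phase.
pose cy : Zq := (map_poly intr c).[y].
have cy2 : cy ^+ 2 = 1 - 4 * y.
  have := congr1 (fun f => (map_poly (intr : int -> Zq) f).[y]) c2.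
  rewrite rmorphXn /= horner_exp -/cy => ->.
  rewrite rmorphD rmorphB !rmorphM /= map_polyXn map_polyX rmorph1 !hornerE.
  rewrite yd mul0r addr0.
  by rewrite rmorph_nat -[4%:R in LHS]polyC_natr hornerC.
have [e he] : exists e, cy = 1 + y * e.
  have [e] := horner_1DX (map_poly intr c) y.
  by rewrite coef_map c0 /= mulr1z; exists e.
pose w : Zq := 1 - 4 * y.
have uw : w \is a GRing.unit.
  rewrite /w yz (_ : _ - _ = 1 + p%:R * (- 4 * z)); last by ring.
  by rewrite unitDp // unitr1.
have ucy : cy \is a GRing.unit by rewrite he yz -mulrA unitDp // unitr1.
pose u' := u * cy / w.
have uu' : u' \is a GRing.unit by rewrite !unitrM uu ucy unitrV uw.
have aE' : a = n * w * u' ^+ 2.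
  transitivity (n * u ^+ 2 * (cy ^+ 2 / w) * (w / w)); last by rewrite /u'; ring.
  by rewrite cy2 divrr // !mulr1.
have phE : 2 * (n * w) * u' = phase.
  transitivity (2 * n * u * cy * (w / w)); first by rewrite /u'; ring.
  by rewrite divrr // mulr1.
have [t cE] : exists t, n * w / u' = n / u + p%:R * t.
  exists (n / u * (- 4 * z + z * e - 4 * z * y * e)).
  transitivity (n / u * (w * cy)); last by rewrite /w he yz; ring.
  apply: (mulIr uu'); rewrite divrK // /u'.
  transitivity (n * (u / u) * (cy ^+ 2 / w) * w); last by ring.
  by rewrite cy2 !divrr // !mulr1.
rewrite -/w aE' (kloosterman_evaluation p_pr k_gt0 psiD psi_norm psi_inj r_lt)
  ?unitrM ?un ?uu ?ucy ?unitrV //.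
rewrite phE cE opprD -[- (p%:R * _)]mulrN.
by rewrite !(ann_gauss_sumDp p_pr k_gt0 psi r_lt kr2 kr3).
Qed.

Variables (g T : nat) (M rt : C) (B : nat -> C).
Hypothesis T_gt0 : (0 < T)%N.
Hypothesis B_ge0 : forall d, 0 <= B d.
Hypothesis leB0 : T%:R <= B 0.
Hypothesis leBS : forall d,
  M + 2 * M * (B d + M / (p ^ g.+1)%:R) <= B d.+1 ^+ 2.
Hypothesis rt_ge0 : 0 <= rt.
Hypothesis rt_sqr : rt ^+ 2 = (p ^ k)%:R.

Lemma ann_gauss_sum_le c : c \is a GRing.unit -> `|ann_gauss_sum psi r c| <= rt.
Proof.
move=> uc; rewrite -(@ler_pXn2r _ 2) ?nnegrE ?normr_ge0 // rt_sqr.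
exact: ann_gauss_sum_bound.
Qed.

(** In a class without solutions of the quadratic equation every term vanishes.
    Otherwise y = w0 x with w0 = - p ^ j / (4 n0), and the phase is a polynomial
    of degree d + 1 in x with leading coefficient of exact order p ^ s up to the
    integer product, whose p-part is less than p ^ V. *)
Lemma kloosterman_class_sum d j s V (m a : Zq) n0 X :
  m \is a GRing.unit -> a \is a GRing.unit -> (0 < j)%N ->
  (k = j * d.+1 + s)%N -> (s <= j)%N -> T = (p ^ s)%N -> (V + g * d <= s)%N ->
  ~~ (p ^ V %| `|\prod_(i < d.+1) (4 * (i : nat)%:R - 2) : int|)%N ->
  X%:R <= M ->
  `|\sum_(0 <= x < X) kloosterman_char psi (m * (n0 + p ^ j * x)%:R) a|
    <= 2 * rt * B d.
Proof.
move=> um ua j0 kE sj TE Vs ndV XM.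
have RHS0 : 0 <= 2 * rt * B d by rewrite !mulr_ge0.
have pj x : (p ^ j * x)%:R = p%:R * (p ^ j.-1 * x)%:R :> Zq.
  by rewrite -natrM mulnA -expnS prednK.
case: (boolP (p %| n0)%N) => [pn0|pn0].
  rewrite big1 ?normr0 // => x _.
  apply: (kloosterman_nonunit p_pr k_gt0 psiD psi_norm psi_inj r_lt) => //.
  rewrite unitrM um /= unit_Zq_natr // negbK dvdn_add // dvdn_mulr //.
  by rewrite -(prednK j0) expnS dvdn_mulr.
have un0 : (n0%:R : Zq) \is a GRing.unit by rewrite unit_Zq_natr.
have un x : ((n0 + p ^ j * x)%:R : Zq) \is a GRing.unit.
  by rewrite natrD pj unitDp.
case: (pickP [pred u | m * n0%:R * u ^+ 2 == a]) => [u /= /eqP aE|nou]; last first.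
  rewrite big1 ?normr0 // => x _.
  apply: (kloosterman_nonresidue p_pr k_gt0 psiD psi_norm psi_inj r_lt) => //.
    by rewrite unitrM um un.
  move=> u; apply/eqP => aE.
  have [w hw] := sqrt_1Dp p_pr k_gt0 ((p ^ j.-1 * x)%:R / n0%:R) odd_p.
  have /eqP[] := nou (u * w).
  rewrite exprMn hw -aE natrD pj.
  transitivity
    (m * u ^+ 2 * (n0%:R + p%:R * (p ^ j.-1 * x)%:R * (n0%:R / n0%:R))).
    by ring.
  by rewrite divrr //; ring.
have uu : u \is a GRing.unit.
  by apply: (@unitr_of_mul_sqr _ (m * n0%:R)); rewrite aE.
have [c [E [sc c0 c2]]] := truncated_sqrt d.+1.
have u4 : (4 : Zq) \is a GRing.unit.
  by rewrite (_ : 4 = 2 * 2) ?unitrM ?two_unit // -natrM.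
pose nu : Zq := - (4 * n0%:R)^-1.
have unu : nu \is a GRing.unit by rewrite unitrN unitrV unitrM u4.
pose w0 : Zq := nu * (p ^ j)%:R.
pose A : Zq := 2 * (m * n0%:R) * u.
have uA : A \is a GRing.unit by rewrite !unitrM two_unit // um un0.
pose f : {poly Zq} := \poly_(i < d.+2) (A * (c`_i)%:~R * w0 ^+ i).
have fE x : f.[x] = A * (map_poly intr c).[w0 * x].
  rewrite horner_poly (@horner_coef_wide _ d.+2) ?(leq_trans (size_poly _ _)) //.
  rewrite mulr_sumr; apply: eq_bigr => i _.
  by rewrite coef_map /= [(w0 * x) ^+ i]exprMn; ring.
have klE x : kloosterman_char psi (m * (n0 + p ^ j * x)%:R) a =
    psi f.[x%:R] * ann_gauss_sum psi r (m * n0%:R / u)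
    + (psi f.[x%:R])^* * ann_gauss_sum psi r (- (m * n0%:R / u)).
  have Hy : (w0 * x%:R) ^+ d.+2 = 0.
    rewrite exprMn [w0 ^+ _]exprMn -natrX -expnM.
    rewrite [(p ^ (j * d.+2))%:R]pX_eq0 ?mulr0 ?mul0r //.
    by rewrite kE [(j * d.+2)%N]mulnS addnC leq_add2r.
  have Hz : exists z, w0 * x%:R = p%:R * z.
    exists (nu * (p ^ j.-1)%:R * x%:R).
    by rewrite /w0 -{1}(prednK j0) expnS natrM; ring.
  have un0' : m * n0%:R \is a GRing.unit by rewrite unitrM um.
  have := kloosterman_sqrt_phase c2 c0 Hy Hz un0' uu (esym aE).
  rewrite /= -[2 * _ * u]/A -fE (charN psiD psi_norm) => <-.
  congr kloosterman_char.
  rewrite natrD natrM.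
  transitivity (m * (n0%:R + (4 * n0%:R / (4 * n0%:R)) * ((p ^ j)%:R * x%:R))).
    by rewrite divrr ?unitrM ?u4 // mul1r.
  by rewrite /w0 /nu; ring.
under eq_bigr => x _ do rewrite klE.
rewrite big_split /= -!mulr_suml -rmorph_sum /=.
have key : `|\sum_(0 <= x < X) psi f.[x%:R]| <= B d.
  have fd : f`_d.+1 = A * (c`_d.+1)%:~R * nu ^+ d.+1 * (p ^ (j * d.+1))%:R.
    by rewrite coef_poly ltnSn [w0 ^+ _]exprMn -natrX -expnM !mulrA.
  apply: (weyl_bound psiD psi_norm psi_inj (prime_gt0 p_pr) T_gt0
    (@dvd_prime_power_Zq g) B_ge0 leB0 leBS) => //.
  - exact: size_poly.
  - by rewrite fd TE -[X in X = _]mulrA -natrM -expnD -kE pX_eq0 ?mulr0.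
  set Pi := \prod_(_ < _) _ in ndV.
  have PiE := truncated_sqrt_lead c2 c0; rewrite -/Pi in PiE.
  apply/eqP => H.
  have H2 : (Pi * (p ^ (j * d.+1 + g * d))%N%:Z)%:~R = 0 :> Zq.
    rewrite -PiE rmorphM rmorphM rmorph_nat /= -pmulrn expnD [(p ^ (g * d))%N]expnM.
    rewrite [(p ^ (j * d.+1) * _)%:R]natrM.
    have U : A * nu ^+ d.+1 \is a GRing.unit by rewrite unitrM uA unitrX.
    apply: (mulrI U); rewrite mulr0; apply: etrans H; rewrite fd.
    move: (d.+1)`!%:R (p ^ (j * d.+1))%:R ((p ^ g) ^ d)%:R
      (c`_d.+1)%:~R (nu ^+ d.+1).
    by move=> x1 x2 x3 x4 x5; move: (A) => x6; ring.
  move/eqP: H2; rewrite (intr_Zq_eq0 p_pr k_gt0) abszM absz_nat => dv.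
  case/negP: ndV; rewrite -(@dvdn_pmul2r (p ^ (j * d.+1 + g * d))); last first.
    by rewrite expn_gt0 prime_gt0.
  by apply: dvdn_trans dv; rewrite -expnD dvdn_exp2l // kE addnCA leq_add2l.
apply: le_trans (ler_normD _ _) _; rewrite !normrM norm_conjC.
have -> : 2 * rt * B d = B d * rt + B d * rt by ring.
have uG : m * n0%:R / u \is a GRing.unit by rewrite !unitrM um un0 unitrV.
by apply: lerD; apply: ler_pM; rewrite ?normr_ge0 ?ann_gauss_sum_le ?unitrN.
Qed.

Lemma kloosterman_char_sum_bound d j s V (m a : Zq) L :
  m \is a GRing.unit -> a \is a GRing.unit -> (0 < j)%N ->
  (k = j * d.+1 + s)%N -> (s <= j)%N -> T = (p ^ s)%N -> (V + g * d <= s)%N ->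
  ~~ (p ^ V %| `|\prod_(i < d.+1) (4 * (i : nat)%:R - 2) : int|)%N ->
  (L %/ p ^ j).+1%:R <= M ->
  `|\sum_(0 <= n < L) kloosterman_char psi (m * n%:R) a|
    <= (p ^ j)%:R * (2 * rt * B d).
Proof.
move=> um ua j0 kE sj TE Vs ndV LM.
rewrite (sum_residue_classes _ L (P := p ^ j)) ?expn_gt0 ?prime_gt0 //.
apply: le_trans (ler_norm_sum _ _ _) _.
rewrite [(p ^ j)%:R * _]mulr_natl -[X in _ *+ X]subn0 -sumr_const_nat.
apply: ler_sum_nat => i _; apply: kloosterman_class_sum kE sj TE Vs ndV _ => //.
by apply: le_trans LM; rewrite ler_nat -[X in (_ <= X)%N]addn1 leq_add2l leq_b1.
Qed.
End ClassSum.

Lemma prod_sqrt_coef_neq0 d : \prod_(i < d) (4 * (i : nat)%:R - 2) != 0 :> int.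
Proof.
by apply/prodf_neq0 => i _; move: (i : nat) => n; clear; lia.
Qed.

(** * Choice of the parameters *)

(** With D = degree + 1, take j = k / D rounded up, so that the terms of degree
    D vanish; then s lies between j - D + 1 and j.  The slack s - V is shared
    between the differencing steps.  The last two inequalities say that
    p ^ (g + 1) is at least a fixed positive power of q, and that p ^ (s + j) is
    at most q ^ (4 / D), which is well below q ^ lambda once lambda D >= 8. *)
Lemma exponent_choice D V k : (1 < D)%N -> (2 * D * (D + V) + 2 <= k)%N ->
  exists j s g, [/\ (0 < j)%N, (k = j * D.-1 + s)%N, (s <= j)%N,
    (V + g * D.-2 <= s)%N &
    (k <= g.+1 * (2 * D ^ 2))%N /\ ((s + j) * D <= 4 * k)%N].
Proof.
move=> D1 kD; pose j := ((k + D.-1) %/ D)%N.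
have D0 := ltnW D1.
have j1 : (j * D <= k + D.-1)%N by exact: leq_divM.
have j2 : (k <= j * D)%N.
  have := divn_eq (k + D.-1) D; have := ltn_pmod (k + D.-1) D0; rewrite -/j.
  move: (j * D)%N (_ %% D)%N => x t; clear -D0; lia.
have jDV : (2 * (D + V) <= j)%N.
  rewrite -(leq_pmul2r D0); apply: leq_trans j2; apply: leq_trans kD.
  by rewrite mulnAC leq_addr.
have jE : (j * D = j * D.-1 + j)%N by rewrite -{1}(prednK D0) mulnS addnC.
have jk : (j * D.-1 <= k)%N by move: j1 jDV; rewrite jE; clear; lia.
pose s := (k - j * D.-1)%N.
have kE : (k = j * D.-1 + s)%N by rewrite subnKC.
have sj : (s <= j)%N by rewrite leq_subLR -jE.
have js : (j <= s + D.-1)%N by move: j1; rewrite jE {1}kE -addnA leq_add2l.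
pose g := ((s - V) %/ D)%N.
have g1 : (g * D <= s - V)%N by exact: leq_divM.
have g2 : (s - V < g.+1 * D)%N by rewrite ltn_ceil.
exists j, s, g; split => //.
- by move: jDV; clear -D0; lia.
- have : (g * D.-2 <= g * D)%N.
    by rewrite leq_mul2l; apply/orP; right; clear; lia.
  by move: g1 js jDV; clear; lia.
split.
- have h : (j <= g.+1 * D + (D + V))%N by move: g2 js jDV; clear; lia.
  have h2 : (2 * k <= 2 * (g.+1 * D + (D + V)) * D)%N.
    by rewrite -mulnA leq_mul2l /= (leq_trans j2) // leq_mul2r h orbT.
  rewrite -(leq_add2r k) addnn -mul2n; apply: leq_trans h2 _.
  have -> : (2 * (g.+1 * D + (D + V)) * D
             = g.+1 * (2 * D ^ 2) + 2 * D * (D + V))%N.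
    by rewrite expnS expn1; ring.
  by rewrite leq_add2l (leq_trans _ kD) // leq_addr.
apply: leq_trans (_ : (2 * (j * D) <= _)%N).
  by rewrite mulnDl mul2n -addnn leq_add2r leq_mul2r sj orbT.
have Dk : (D <= k)%N.
  apply: leq_trans kD; apply: leq_trans (leq_addr _ _).
  rewrite mulnAC mulnC leq_pmulr //.
  by rewrite muln_gt0 /= addn_gt0 D0.
by move: j1 Dk; clear; lia.
Qed.

(** * The Kloosterman sums over the complex numbers *)

Section Character.
Variable R : realType.

Lemma e_unitD (x y : R) : e_unit (x + y) = e_unit x * e_unit y.
Proof.
rewrite /e_unit mulrDr cosD sinD; apply/eqP; rewrite eq_complex /=.
by rewrite eqxx /= addrC [cos _ * sin _]mulrC; apply/eqP; ring.
Qed.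

Lemma e_unit0 : e_unit (0 : R) = 1.
Proof. by rewrite /e_unit mulr0 cos0 sin0. Qed.

Lemma norm_e_unit (x : R) : `|e_unit x| = 1.
Proof. by rewrite normc_def /= cos2Dsin2 sqrtr1. Qed.

Lemma e_unit1 : e_unit (1 : R) = 1.
Proof. by rewrite /e_unit mulr1 mulr_natl cos2pi sin2pi. Qed.

Lemma e_unit_nat n : e_unit (n%:R : R) = 1.
Proof.
elim: n => [|n IH]; first exact: e_unit0.
by rewrite -natr1 e_unitD IH e_unit1 mulr1.
Qed.

Lemma e_unit_int (z : int) : e_unit (z%:~R : R) = 1.
Proof.
case: z => n; first exact: e_unit_nat.
have := e_unitD (- n.+1%:R) n.+1%:R.
by rewrite addNr e_unit0 e_unit_nat mulr1 NegzE mulrNz.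
Qed.

Lemma e_unit_eq1 (x : R) : 0 <= x < 1 -> e_unit x = 1 -> x = 0.
Proof.
case/andP=> x0 x1 /(congr1 (@complex.Re R)) /= H.
apply/eqP; move: x0; rewrite le_eqVlt => /orP[/eqP<-//|x0].
have : 0 < sin (pi * x).
  by apply: sin_gt0_pi; rewrite ?mulr_gt0 ?pi_gt0 // gtr_pMr ?pi_gt0.
have : cos (2 * pi * x) = 1 - 2 * sin (pi * x) ^+ 2.
  have -> : 2 * pi * x = pi * x + pi * x by ring.
  by rewrite cosD -!expr2 cos2sin2; ring.
rewrite H => E S0; have S2 : sin (pi * x) ^+ 2 = 0 by lra.
by move/eqP: S2; rewrite sqrf_eq0 gt_eqF.
Qed.

Variables (p k : nat).
Hypothesis p_pr : prime p.
Hypothesis k_gt0 : (0 < k)%N.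
Local Notation Zq := 'Z_(p ^ k).

Definition e_mod (x : Zq) : R[i] := e_unit ((x : nat)%:R / (p ^ k)%:R).

Let q_neq0 : (p ^ k)%:R != 0 :> R.
Proof. by rewrite pnatr_eq0 -lt0n expn_gt0 prime_gt0. Qed.

Lemma e_mod_int (z : int) : e_mod z%:~R = e_unit (z%:~R / (p ^ k)%:R).
Proof.
set x : Zq := z%:~R.
have : (p ^ k %| `|(z - (x : nat)%:Z)%R|)%N.
  by rewrite -intr_Zq_eq0 // rmorphB /= -[X in _ - X]pmulrn -Zq_natr subrr.
rewrite -[X in (X %| _)%N]absz_nat -dvdzE => /dvdzP[y hy].
have -> : z = (x : nat)%:Z + y * (p ^ k)%N%:Z by rewrite -hy; ring.
by rewrite rmorphD rmorphM /= mulrDl mulfK // e_unitD e_unit_int mulr1.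
Qed.

Lemma e_mod_add x y : e_mod (x + y) = e_mod x * e_mod y.
Proof.
have -> : x + y = ((x : nat)%:Z + (y : nat)%:Z)%:~R.
  by rewrite rmorphD /= -!pmulrn -!Zq_natr.
by rewrite e_mod_int rmorphD /= mulrDl e_unitD.
Qed.

Lemma e_mod_unimodular x : `|e_mod x| = 1.
Proof. exact: norm_e_unit. Qed.

Lemma e_mod_faithful x : e_mod x = 1 -> x = 0.
Proof.
move=> H; have q0 : 0 < (p ^ k)%:R :> R by rewrite ltr0n expn_gt0 prime_gt0.
have xq : ((x : nat) < p ^ k)%N.
  by rewrite -[X in (_ < X)%N]Zp_cast ?prime_power_gt1.
have: (x : nat)%:R / (p ^ k)%:R = 0 :> R.
  apply: e_unit_eq1 H.
  by rewrite divr_ge0 ?ler0n //= ltr_pdivrMr // mul1r ltr_nat.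
move/eqP; rewrite mulf_eq0 invr_eq0 (negbTE q_neq0) orbF pnatr_eq0 => /eqP x0.
exact: val_inj.
Qed.

Lemma kloosterman_as_char (n a : int) :
  kloosterman R n a (p ^ k) = kloosterman_char e_mod n%:~R a%:~R.
Proof.
pose F b := e_mod (n%:~R * b%:R + a%:~R / b%:R).
transitivity (\sum_(0 <= b < p ^ k | coprime b (p ^ k)) F b).
  rewrite big_mkord; apply: eq_bigr => b cop.
  rewrite -e_mod_int /F; congr e_mod.
  rewrite rmorphD !rmorphM /= -!pmulrn; congr (_ + _ * _).
  have ub : (b%:R : Zq) \is a GRing.unit.
    by rewrite unitZpE ?prime_power_gt1 // coprime_sym.
  apply: (mulrI ub); rewrite divrr // -natrM.
  apply/eqP; rewrite -(inj_eq val_inj) /= val_Zp_nat ?prime_power_gt1 //.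
  by rewrite mul_inv_mod // modn_small ?prime_power_gt1.
rewrite -[X in \sum_(0 <= b < X | _) _](Zp_cast (prime_power_gt1 p_pr k_gt0)).
rewrite big_mkord; apply: eq_big => b.
  by rewrite [in RHS](Zq_natr b) unitZpE ?prime_power_gt1 // coprime_sym.
by move=> _; rewrite /F -(Zq_natr b).
Qed.

Lemma unit_Zq_intr (z : int) :
  ~~ (p %| `|z|)%N -> (z%:~R : Zq) \is a GRing.unit.
Proof.
case: z => n; first by rewrite -pmulrn unit_Zq_natr.
by rewrite NegzE mulrNz unitrN -pmulrn unit_Zq_natr.
Qed.

End Character.

(** The constant 5 is one that reproduces itself in the differencing recursion:
    the left side is at most (1 + 10 + 2) M ^ 2 rho, below 25 M ^ 2 rho. *)
Lemma weyl_recursion (R : realType) (M e rho x t : R) :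
  0 <= M -> 1 <= e * M -> e <= rho -> rho <= 1 -> x ^+ 2 = rho -> t <= e ->
  M + 2 * M * (5 * M * rho + M * t) <= (5 * M * x) ^+ 2.
Proof.
move=> M0 eM er r1 xr te.
have -> : (5 * M * x) ^+ 2 = 25 * M ^+ 2 * rho by rewrite -xr; ring.
have h1 : M <= M ^+ 2 * rho.
  apply: le_trans (_ : M * (e * M) <= _); first by rewrite ler_peMr.
  by rewrite mulrCA -expr2 mulrC ler_wpM2l // exprn_ge0.
have h2 : M * (M * t) <= M ^+ 2 * rho.
  by rewrite mulrA -expr2 ler_wpM2l ?exprn_ge0 // (le_trans te).
have h3 : 0 <= M ^+ 2 * rho by exact: le_trans h1.
rewrite mulrDr; have -> : 2 * M * (5 * M * rho) = 10 * (M ^+ 2 * rho) by ring.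
have -> : 2 * M * (M * t) = 2 * (M * (M * t)) by ring.
have -> : 25 * M ^+ 2 * rho = 25 * (M ^+ 2 * rho) by ring.
lra.
Qed.

(** The parameter [eta] bounds both sources of loss in Weyl differencing: the
    proportion of shifts divisible by p ^ (g + 1), and the ratio of p ^ s to the
    length 3 N / p ^ j allowed for each residue class. *)
Lemma kloosterman_sum_bound (R : realType) (p k d j s V g : nat) (m a : int)
    (N eta : R) :
  prime p -> odd p -> (1 < k)%N -> coprimez (m * a) p%:Z ->
  (0 < j)%N -> (k = j * d.+1 + s)%N -> (s <= j)%N -> (V + g * d <= s)%N ->
  ~~ (p ^ V %| `|\prod_(i < d.+1) (4 * (i : nat)%:R - 2) : int|)%N ->
  0 < eta -> eta <= 1 -> (p ^ g.+1)%:R^-1 <= eta ->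
  (p ^ s)%:R * (p ^ j)%:R <= eta * N ->
  `|\sum_(1 <= n < (Num.truncn N).+1) kloosterman R (m * n%:Z) a (p ^ k)|
    <= (30 * N * Num.sqrt (p ^ k)%:R * eta `^ (2^-1 ^+ d))%:C%C.
Proof.
move=> p_pr odd_p k1 cop j0 kE sj Vs ndV eta0 eta1 gE sE.
have r_lt : (k - k./2 < k)%N by clear -k1; lia.
have kr : (k <= 2 * (k - k./2))%N by clear -k1; lia.
have k0 := ltnW k1.
have pX0 i : 0 < (p ^ i)%:R :> R by rewrite ltr0n expn_gt0 prime_gt0.
have pX1 i : 1 <= (p ^ i)%:R :> R by rewrite ler1n expn_gt0 prime_gt0.
have um : (m%:~R : 'Z_(p ^ k)) \is a GRing.unit.
  apply: unit_Zq_intr => //; rewrite -prime_coprime // coprime_sym.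
  by move: cop; rewrite coprimezMl => /andP[].
have ua : (a%:~R : 'Z_(p ^ k)) \is a GRing.unit.
  apply: unit_Zq_intr => //; rewrite -prime_coprime // coprime_sym.
  by move: cop; rewrite coprimezMl => /andP[].
pose P : R := (p ^ j)%:R; have P0 : 0 < P by exact: pX0.
have PN : P <= N.
  apply: le_trans (_ : eta * N <= _).
    by apply: le_trans sE; rewrite ler_peMl // ltW.
  have N0 : 0 <= N.
    rewrite -(pmulr_rge0 _ eta0); apply: le_trans sE; by rewrite mulr_ge0 ?ler0n.
  by rewrite ler_piMl.
have N0 : 0 < N by exact: lt_le_trans PN.
pose M : R := 3 * N / P.
have M0 : 0 < M by rewrite divr_gt0 // mulr_gt0 // ltr0n.
pose B (i : nat) : R := 5 * M * eta `^ (2^-1 ^+ i).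
have B0 i : 0 <= B i by rewrite mulr_ge0 ?powR_ge0 // mulr_ge0 // ltW.
have etaM : (p ^ s)%:R <= eta * M.
  rewrite /M mulrA ler_pdivlMr //; apply: le_trans sE _.
  by rewrite ler_pM2l //; lra.
have half i : 0 <= (2^-1 : R) ^+ i <= 1.
  by rewrite exprn_ge0 ?exprn_ile1 // invf_le1 ?ler1n // ltr0n.
have etap i : eta <= eta `^ (2^-1 ^+ i) <= 1.
  have /andP[h0 h1] := half i; have e01 : 0 < eta <= 1 by rewrite eta0.
  by rewrite ger1_powR //= -[X in _ <= X](powRr0 eta) ger_powR.
have leB0 : (p ^ s)%:R <= (B 0)%:C%C.
  rewrite -[(p ^ s)%:R](rmorph_nat (real_complex R)) lecR.
  apply: le_trans etaM _; rewrite /B expr0 (powRr1 (ltW eta0)).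
  rewrite [eta * M]mulrC ler_pM2r //; lra.
have leBS i : M%:C%C + 2 * M%:C%C * ((B i)%:C%C + M%:C%C / (p ^ g.+1)%:R)
    <= (B i.+1)%:C%C ^+ 2.
  rewrite -(rmorph_nat (real_complex R) 2).
  rewrite -(rmorph_nat (real_complex R) (p ^ g.+1)).
  rewrite -fmorphV -!rmorphM -rmorphD -rmorphM -rmorphD -rmorphXn lecR.
  apply: (@weyl_recursion _ M eta) => //; first exact: ltW.
  - exact: le_trans (pX1 s) etaM.
  - by have /andP[] := etap i.
  - by have /andP[] := etap i.
  - by rewrite -powR_mulrn ?powR_ge0 // -powRrM exprS mulrAC mulVf ?mul1r.
pose rt : R[i] := (Num.sqrt (p ^ k)%:R)%:C%C.
have rt0 : 0 <= rt by rewrite -(rmorph0 (real_complex R)) lecR sqrtr_ge0.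
have rt2 : rt ^+ 2 = (p ^ k)%:R.
  by rewrite -rmorphXn /= sqr_sqrtr ?ler0n // (rmorph_nat (real_complex R)).
have BC0 i : 0 <= (B i)%:C%C :> R[i] by rewrite -(rmorph0 (real_complex R)) lecR.
have T0 : (0 < p ^ s)%N by rewrite expn_gt0 prime_gt0.
set L := (Num.truncn N).+1.
have LM : (L %/ p ^ j).+1%:R <= M%:C%C :> R[i].
  rewrite -(rmorph_nat (real_complex R)) lecR -natr1 /M ler_pdivlMr //.
  rewrite mulrDl mul1r.
  have h1 : (L %/ p ^ j)%:R * P <= L%:R by rewrite -natrM ler_nat leq_divM.
  have h2 : L%:R <= N + 1 by rewrite -natr1 lerD2r Num.Theory.truncn_le // ltW.
  have h3 : 1 <= P by exact: pX1.
  apply: le_trans (_ : (N + 1) + P <= _); first by rewrite lerD2r (le_trans h1).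
  lra.
have psiD := @e_mod_add R p k p_pr k0.
have psi_norm := @e_mod_unimodular R p k.
have psi_inj := @e_mod_faithful R p k p_pr k0.
have main := kloosterman_char_sum_bound p_pr odd_p k1 psiD psi_norm psi_inj
  T0 BC0 leB0 leBS rt0 rt2 um ua j0 kE sj (erefl _) Vs ndV LM.
(* The term n = 0 is harmless: 0 is not a unit, so its sum vanishes. *)
have -> : \sum_(1 <= n < L) kloosterman R (m * n%:Z) a (p ^ k) =
    \sum_(0 <= n < L) kloosterman_char (@e_mod R p k) (m%:~R * n%:R) a%:~R.
  rewrite [RHS]big_ltn //.
  rewrite (kloosterman_nonunit p_pr k0 psiD psi_norm psi_inj r_lt kr)
    ?mulr0 ?unitr0 //.
  rewrite add0r; apply: eq_bigr => n _.
  by rewrite kloosterman_as_char // rmorphM /= -pmulrn.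
apply: le_trans main _.
rewrite /rt -(rmorph_nat (real_complex R) 2).
rewrite -(rmorph_nat (real_complex R) (p ^ j)).
rewrite -!rmorphM lecR /B /M -/P.
rewrite le_eqVlt; apply/orP; left; apply/eqP.
by field; rewrite gt_eqF.
Qed.

Theorem corollary1p3 (R : realType) (lambda : R) (hlambda : 0 < lambda) :
  exists (k0 : nat) (tau c : R), [/\ 0 < tau, 0 < c &
    forall (p k : nat) (m a : int) (N : R),
      prime p -> odd p -> (k0 <= k)%N -> coprimez (m * a) p%:Z ->
      (p ^ k)%:R `^ lambda <= N -> N <= (p ^ k)%:R ->
      \sum_(1 <= n < (Num.truncn N).+1) kloosterman R (m * n%:Z) a (p ^ k)
        = \sum_(1 <= n < (Num.truncn N).+1) kloosterman R a (m * n%:Z) (p ^ k)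
      /\ `| \sum_(1 <= n < (Num.truncn N).+1)
              kloosterman R (m * n%:Z) a (p ^ k) |
         <= (c * N * (p ^ k)%:R `^ (2^-1 - tau))%:C%C].
Proof.
pose d := Num.truncn (8 / lambda); pose D := d.+2.
pose V := `|\prod_(i < d.+1) (4 * (i : nat)%:R - 2) : int|%N.
pose sigma : R := (2 * D ^ 2)%:R^-1.
have sigma0 : 0 < sigma by rewrite invr_gt0 ltr0n.
have lamD : 8 <= lambda * D%:R.
  rewrite mulrC -ler_pdivrMr //; apply/ltW.
  apply: lt_le_trans (truncnS_gt _) _; by rewrite ler_nat.
exists (2 * D * (D + V) + 2)%N, (sigma * 2^-1 ^+ d), 30; split => //.
  by rewrite mulr_gt0 // exprn_gt0 // invr_gt0 ltr0n.
move=> p k m a N p_pr odd_p kD cop qN Nq.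
have k1 : (1 < k)%N by apply: leq_trans kD; rewrite addn2.
have k0 := ltnW k1.
split.
  apply: eq_bigr => n _; rewrite !kloosterman_as_char //.
  exact: kloosterman_charC.
have [j [s [g [j0 kE sj Vs [gk sjk]]]]] := exponent_choice (isT : (1 < D)%N) kD.
set q : R := (p ^ k)%:R in qN Nq *.
have p1 : 1 <= p%:R :> R by rewrite ler1n prime_gt0.
have q1 : 1 <= q by rewrite ler1n expn_gt0 prime_gt0.
have q0 : 0 < q by exact: lt_le_trans q1.
have pE i : (p ^ i)%:R = p%:R `^ i%:R :> R by rewrite natrX powR_mulrn ?ler0n.
have qE x : q `^ x = p%:R `^ (k%:R * x) by rewrite /q pE -powRrM.
have DR : 0 < D%:R :> R by rewrite ltr0n.
have kR : 0 < k%:R :> R by rewrite ltr0n.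
have qD x y : q `^ (x + y) = q `^ x * q `^ y.
  by rewrite powRD // (gt_eqF q0) implybT.
pose eta : R := q `^ (- sigma).
have eta0 : 0 < eta by exact: powR_gt0.
have eta1 : eta <= 1 by rewrite -(powRr0 q) ler_powR // oppr_le0 ltW.
have gE : (p ^ g.+1)%:R^-1 <= eta.
  rewrite /eta powRN lef_pV2 ?posrE ?powR_gt0 ?ltr0n ?expn_gt0 ?prime_gt0 //.
  by rewrite pE qE ler_powR // ler_pdivrMr ?ltr0n // -natrM ler_nat.
have sE : (p ^ s)%:R * (p ^ j)%:R <= eta * N.
  apply: le_trans (_ : eta * q `^ lambda <= _); last by rewrite ler_pM2l.
  rewrite -natrM -expnD pE /eta -qD qE ler_powR //.
  have h1 : (s + j)%:R * D%:R <= 4 * k%:R :> R by rewrite -!natrM ler_nat.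
  have h2 : sigma * D%:R <= 1.
    rewrite /sigma mulrC ler_pdivrMr ?ltr0n // mul1r ler_nat.
    by rewrite expnS expn1 mulnCA leq_pmulr.
  rewrite -(ler_pM2r DR); apply: le_trans h1 _; rewrite mulrC -mulrA ler_pM2l //.
  by rewrite mulrDl mulNr; lra.
(* V is the integer itself rather than its p-adic valuation: this is enough,
   since p ^ v > v, and makes V independent of p. *)
have V0 : ~~ (p ^ V %| V)%N.
  have ndvd v : (0 < v)%N -> ~~ (p ^ v %| v)%N.
    by move=> v0; rewrite gtnNdvd // ltn_expl // prime_gt1.
  by apply: ndvd; rewrite absz_gt0; apply: prod_sqrt_coef_neq0.
have := kloosterman_sum_bound p_pr odd_p k1 cop j0 kE sj Vs V0 eta0 eta1 gE sE.
rewrite -(powR12_sqrt (ltW q0)) /eta -powRrM -[_ * q `^ _ * _]mulrA -qD mulNr.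
exact.
Qed.
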